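(* Let $\alpha,\beta,t_0$ be real numbers with $\beta\ge0$, $t_0>0$, let $u_0,v_0\in\mathcal{H}$, and let $x:[t_0,+\infty)\to\mathcal{H}$ be the unique global $C^2$-solution of $$\ddot{x}(t)+\frac{\alpha}{t}\dot{x}(t)+\beta\nabla^2 g(x(t))\dot{x}(t)+\nabla g(x(t))+\epsilon(t)x(t)=0\quad (t\ge t_0),\qquad x(t_0)=u_0,\ \dot{x}(t_0)=v_0.$$ Assume that $\int_{t_0}^{+\infty}t\,\epsilon(t)\,dt<+\infty$ and that one of the following conditions is fulfilled: (a) there exist $a>1$ and $t_1\ge t_0$ such that $\dot{\epsilon}(t)\le-\frac{a\beta}{2}\epsilon^2(t)$ for every $t\ge t_1$; (b) there exist $a>0$ and $t_1\ge t_0$ such that $\epsilon(t)\le\frac{a}{t}$ for every $t\ge t_1$. Let $x^*\in\operatorname{argmin} g$ be arbitrary. If $\alpha>3$, then the function $t\mapsto t\langle\nabla g(x(t)),x(t)-x^*\rangle$ belongs to $L^1([t_0,+\infty),\mathbb{R})$, and the limits $$\lim_{t\to+\infty}\|x(t)-x^*\|\in\mathbb{R}\quad\text{and}\quad \lim_{t\to+\infty}t\langle\dot{x}(t)+\beta\nabla g(x(t)),x(t)-x^*\rangle\in\mathbb{R}$$ exist. In addition, as $t\to+\infty$, $$g(x(t))-\min g=o\left(\frac{1}{t^2}\right),\qquad \|\dot{x}(t)+\beta\nabla g(x(t))\|=o\left(\frac{1}{t}\right),\qquad \lim_{t\to+\infty}t^2\epsilon(t)\|x(t)\|^2=0.$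$
   Context: $\mathcal{H}$ is a real Hilbert space. Standing assumptions: $g:\mathcal{H}\to\mathbb{R}$ is convex and twice Fréchet differentiable, its gradient $\nabla g$ is Lipschitz continuous on bounded sets, and $\operatorname{argmin} g\ne\emptyset$; $\epsilon:[t_0,+\infty)\to[0,+\infty)$ is nonincreasing, of class $C^1$, with $\lim_{t\to+\infty}\epsilon(t)=0$. $\min g\in\mathbb{R}$ denotes the minimal value of $g$. *)

(* Defs.v *)
From HB Require Import structures.
From mathcomp Require Export all_boot all_order all_algebra sesquilinear.
From mathcomp Require Export all_classical all_reals all_analysis.

Set Implicit Arguments.
Unset Strict Implicit.
Unset Printing Implicit Defensive.

Import Order.TTheory GRing.Theory Num.Theory.
Import numFieldNormedType.Exports.

Local Open Scope classical_set_scope.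
Local Open Scope ring_scope.

(* Needed to write [f =o_ (pinfty_nbhs R) g]: the library packages the
   filter \oo on nat in this way but not the filter +oo on a field. *)
Canonical pinfty_filter_on (R : numFieldType) : filter_on R :=
  FilterType (pinfty_nbhs R) _.

Section DerivativesOnASet.
Context {R : realType} {V : normedModType R}.
Implicit Types (A : set R) (f : R -> V) (t : R).

(* The library's [derivable] and [f^`()] are two-sided. Functions with domain
   [t0, +oo[ are represented here by total functions whose values below t0 are
   irrelevant, so difference quotients are restricted to the domain A; at
   t0 this gives the right derivative. *)
Definition diff_quotient f t : R -> V := fun s => (s - t)^-1 *: (f s - f t).

Definition derivable_in A f t : Prop :=
  cvg (diff_quotient f t @ within A t^').

Definition derive_in A f t : V := lim (diff_quotient f t @ within A t^').

Definition C1_on A f : Prop :=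
  (forall t, A t -> derivable_in A f t) /\
  {within A, continuous (derive_in A f)}.

Definition C2_on A f : Prop := C1_on A f /\ C1_on A (derive_in A f).

End DerivativesOnASet.

Section Hilbert.
Context {R : realType} {H : completeNormedModType R}.

(* The complete norm of H is the one induced by the inner product. *)
Definition inner_product_norm (ip : {dot H for (@idfun R)}) : Prop :=
  forall u : H, `|u| ^+ 2 = ip u u.

Variable ip : {dot H for (@idfun R)}.
Implicit Types (g : H -> R) (x v : H).

(* The Riesz representative of the Fréchet differential of g at x. *)
Definition gradient g x : H := get [set w : H | forall h, 'd g x h = ip w h].

Definition hessian g x : H -> H := 'd (gradient g) x.

(* Through the Riesz isometry between H and its dual, differentiability of
   x |-> 'd g x is differentiability of the gradient. *)
Definition twice_differentiable g : Prop :=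
  (forall x, differentiable g x) /\ (forall x, differentiable (gradient g) x).

Definition argmin g : set H := [set x | forall y, g x <= g y].

Definition min_value g : R := inf (range g).

Definition lipschitz_on_bounded_sets (F : H -> H) : Prop :=
  forall B : set H, bounded_set B -> [lipschitz F z | z in B].

Definition tikhonov_hessian_solution g (eps : R -> R) (alpha beta t0 : R)
    (u0 v0 : H) (x : R -> H) : Prop :=
  let I : set R := `[t0, +oo[%classic in
  let x' := derive_in I x in
  let x'' := derive_in I x' in
  [/\ C2_on I x,
      forall t, t0 <= t ->
        x'' t + (alpha / t) *: x' t + beta *: hessian g (x t) (x' t)
          + gradient g (x t) + eps t *: x t = 0,
      x t0 = u0
    & x' t0 = v0].

End Hilbert.

(* Main.v *)
(* With y = x - xstar, D = grad g(x), G = g(x) - min g, v = x' + beta D, the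
   energies E_b = q + b p, where
     p = - beta t G + t <y, v> + (alpha - 1)/2 |y|^2,
     q = r + beta (alpha - 2) t G,
     r = t^2 G + t^2 eps/2 |x|^2 + t^2/2 |v|^2,
   are affine in b, eventually nonnegative, and for 2 < b < alpha - 1 satisfy
     E_b' <= C t eps - c (t <y, D> + t |x'|^2 + t eps |x|^2 + beta t^2 |D|^2).
   As t eps is integrable, E_b converges; two values of b give the convergence
   of p and q, and t G -> 0 since t^2 G is bounded, so r converges too.  Its
   limit vanishes because r/t is integrable while 1/t is not.  Finally
   k = |y|^2/2 + beta int <y, D> satisfies t k' + (alpha - 1) k =
   p + beta t G + beta (alpha - 1) int <y, D>, which converges; hence so does
   k, and with it |y|. *)
Require Import Defs.
From mathcomp Require Import ring lra.
From mathcomp Require Import measurable_realfun.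

Set Implicit Arguments.
Unset Strict Implicit.
Unset Printing Implicit Defensive.

Import Order.TTheory GRing.Theory Num.Theory.
Import numFieldNormedType.Exports.

Local Open Scope classical_set_scope.
Local Open Scope ring_scope.

(** * Real inner products *)

Section InnerProduct.
Context {R : realType} {H : completeNormedModType R}.
Context (ip : {dot H for (@idfun R)}) (ip_norm : inner_product_norm ip).
Implicit Types (u v w : H) (a : R).

Lemma ipC u v : ip u v = ip v u.
Proof. by have := hermC ip u v; rewrite /= expr0 mul1r. Qed.

Lemma ipDl u v w : ip (u + v) w = ip u w + ip v w.
Proof. exact: linearDl. Qed.

Lemma ipDr u v w : ip u (v + w) = ip u v + ip u w.
Proof. by rewrite ipC ipDl !(ipC u). Qed.

Lemma ipZl a u v : ip (a *: u) v = a * ip u v.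
Proof. exact: linearZl_LR. Qed.

Lemma ipZr a u v : ip u (a *: v) = a * ip u v.
Proof. by rewrite ipC ipZl ipC. Qed.

Lemma ipNl u v : ip (- u) v = - ip u v.
Proof. by rewrite -scaleN1r ipZl mulN1r. Qed.

Lemma ipNr u v : ip u (- v) = - ip u v.
Proof. by rewrite ipC ipNl ipC. Qed.

Lemma ip0l v : ip 0 v = 0.
Proof. by rewrite -(scale0r 0) ipZl mul0r. Qed.

Lemma ip0r v : ip v 0 = 0.
Proof. by rewrite ipC ip0l. Qed.

Definition ipE := (ipDl, ipDr, ipZl, ipZr, ipNl, ipNr, ip0l, ip0r).

Lemma ip_ge0 u : 0 <= ip u u.
Proof. by rewrite -ip_norm sqr_ge0. Qed.

(** Expanding | |u|^2 v - <u, v> u |^2 >= 0 gives the squared inequality multiplied by |u|^2. *)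
Lemma cauchy_schwarz u v : `|ip u v| <= `|u| * `|v|.
Proof.
have [->|u0] := eqVneq u 0; first by rewrite ip0l !normr0 mul0r.
have uu : 0 < ip u u by rewrite -ip_norm exprn_gt0// normr_gt0.
rewrite -(@ler_pXn2r _ 2)// ?nnegrE ?mulr_ge0// exprMn !ip_norm.
rewrite real_normK ?num_real//.
rewrite -subr_ge0 -(pmulr_rge0 _ uu).
have -> : ip u u * (ip u u * ip v v - ip u v ^+ 2) =
    ip (ip u u *: v - ip u v *: u) (ip u u *: v - ip u v *: u).
  by rewrite !ipE (ipC v u); ring.
exact: ip_ge0.
Qed.

(** The inner product is split around its limit as <f - u, h - v> + <f - u, v> + <u, h - v> + <u,
    v>; by Cauchy-Schwarz the first three terms vanish in the limit. *)
Lemma cvg_ip {T : Type} {F : set_system T} {FF : Filter F} (f h : T -> H) u v :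
  f @ F --> u -> h @ F --> v -> ip (f t) (h t) @[t --> F] --> ip u v.
Proof.
move=> fu hv.
have -> : (fun t => ip (f t) (h t)) =
    (fun t => ip (f t - u) (h t - v) + ip (f t - u) v + ip u (h t - v) + ip u v).
  by apply/funext => t; rewrite !ipE; ring.
rewrite -[X in _ --> X]add0r; apply: cvgD; last exact: cvg_cst.
have Z (k : T -> R) (B : T -> R) : (forall t, `|k t| <= B t) ->
    B t @[t --> F] --> 0 -> k t @[t --> F] --> 0.
  move=> kB B0; apply/norm_cvg0P.
  apply: (@squeeze_cvgr _ _ _ _ (cst 0) B) => //; last exact: cvg_cst.
  by near=> t; rewrite normr_ge0 kB.
have fu0 : `|f t - u| @[t --> F] --> 0.
  by rewrite -(@normr0 _ H) -(subrr u); apply: cvg_norm; apply: cvgB => //; exact: cvg_cst.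
have hv0 : `|h t - v| @[t --> F] --> 0.
  by rewrite -(@normr0 _ H) -(subrr v); apply: cvg_norm; apply: cvgB => //; exact: cvg_cst.
rewrite -[X in _ --> X]addr0; apply: cvgD.
  rewrite -[X in _ --> X]addr0; apply: cvgD.
  - apply: (Z _ _ (fun t => cauchy_schwarz _ _)).
    by rewrite -(mulr0 0); apply: cvgM.
  - apply: (Z _ _ (fun t => cauchy_schwarz _ _)).
    by rewrite -(mul0r `|v|); apply: cvgM => //; exact: cvg_cst.
- apply: (Z _ _ (fun t => cauchy_schwarz _ _)).
  by rewrite -(mulr0 `|u|); apply: cvgM => //; exact: cvg_cst.
Unshelve. all: by end_near. Qed.

Lemma is_derive_ip (f h : R -> H) (t : R) df dh :
  is_derive t (1 : R) f df -> is_derive t (1 : R) h dh ->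
  is_derive t (1 : R) (fun s => ip (f s) (h s)) (ip df (h t) + ip (f t) dh).
Proof.
move=> [fd fE] [hd hE].
(* In the product rule the increment of [h] is paired with [f] at the shifted point, so continuity
   of [f] at [t] enters. *)
have fc : f (s *: (1 : R) + t) @[s --> 0^'] --> f t.
  have : {for t, continuous f}.
    by apply: differentiable_continuous; apply/derivable1_diffP.
  have : s *: (1 : R) + t @[s --> (0 : R)^'] --> (0 : R) *: (1 : R) + t.
    apply: cvgD; last exact: cvg_cst.
    by apply: cvgZr_tmp; apply: cvg_within.
  rewrite scale0r add0r => st fc.
  by apply: cvg_trans fc; exact: (cvg_app f st).
suff K : s^-1 *: (ip (f (s *: (1 : R) + t)) (h (s *: (1 : R) + t)) - ip (f t) (h t))
    @[s --> 0^'] --> ip df (h t) + ip (f t) dh.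
  by apply: DeriveDef; [apply/cvg_ex; eexists; exact: K|apply/cvg_lim].
have -> : (fun s => s^-1 *: (ip (f (s *: (1 : R) + t)) (h (s *: (1 : R) + t))
                             - ip (f t) (h t))) =
  (fun s => ip (s^-1 *: (f (s *: (1 : R) + t) - f t)) (h t) +
            ip (f (s *: (1 : R) + t)) (s^-1 *: (h (s *: (1 : R) + t) - h t))).
  by apply/funext => s; rewrite !ipE /GRing.scale/=; ring.
apply: cvgD; apply: cvg_ip => //.
- by rewrite -fE; exact: fd.
- exact: cvg_cst.
- by rewrite -hE; exact: hd.
Qed.

End InnerProduct.

(** * Riesz representation, gradients and convexity *)

Section Gradient.
Context {R : realType} {H : completeNormedModType R}.
Context (ip : {dot H for (@idfun R)}) (ip_norm : inner_product_norm ip).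
Implicit Types (u v w : H) (a : R).

(* The Riesz representative of f minimises |u|^2 / 2 - f u; minimising
   sequences are Cauchy by the parallelogram identity. *)
Lemma riesz_representation (f : {linear H -> R}) :
  continuous f -> exists w, forall h, f h = ip w h.
Proof.
move=> fc; have [k k0 fk] := linear_lipschitz fc.
have fZ a v : f (a *: v) = a * f v by exact: linearZ.
have fD v w : f (v + w) = f v + f w by exact: linearD.
pose J u := ip u u / 2 - f u.
have J_lb : has_lbound (range J).
  exists (- (k ^+ 2 / 2)) => _ [u _ <-]; rewrite /J -ip_norm.
  have := fk u; rewrite ler_norml => /andP[_ fu].
  have : 0 <= (`|u| - k) ^+ 2 by exact: sqr_ge0.
  lra.
have J_inf : has_inf (range J) by split => //; exists (J 0), 0.
have Jge u : inf (range J) <= J u by apply: ge_inf => //; exists u.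
have /choice[u uP] : forall n : nat, exists u, J u < inf (range J) + n.+1%:R^-1.
  move=> n; have [|_ [u _ <-] Ju] := @inf_adherent _ (range J) n.+1%:R^-1 _ J_inf.
    by rewrite invr_gt0.
  by exists u.
(* The parallelogram identity for [J]: the linear parts of the three values cancel. *)
have par v w : ip (v - w) (v - w) / 4 = J v + J w - 2 * J (2^-1 *: (v + w)).
  by rewrite /J fZ fD !(ipE, ipC ip w v); field.
have u_cvg : cvg (u @ \oo).
  apply: cauchy_cvg; apply: cauchy_exP => e e0.
  (* Two values of [J] within e^2/8 of the infimum give |u N - u n|^2 / 4 < e^2 / 4 by [par]. *)
  have e8 : 0 < e ^+ 2 / 8 by rewrite divr_gt0 ?exprn_gt0.
  near \oo => N; exists (u N).
  suff : \forall n \near \oo, ball (u N) e (u n) by []; near=> n.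
  rewrite -ball_normE/=.
  rewrite -ltr_sqr ?nnegrE ?(ltW e0)// ip_norm.
  have dN : N.+1%:R^-1 < e ^+ 2 / 8 :> R.
    by near: N; exact: (near_infty_natSinv_lt (PosNum e8)).
  have dn : n.+1%:R^-1 < e ^+ 2 / 8 :> R.
    by near: n; exact: (near_infty_natSinv_lt (PosNum e8)).
  have := par (u N) (u n); have := uP N; have := uP n.
  have := Jge (2^-1 *: (u N + u n)).
  by move: dN dn; set A := ip _ _; move: (N.+1%:R^-1) (n.+1%:R^-1) => a b; lra.
have /cvg_ex[w uw] := u_cvg.
have Jw v : J w <= J v.
  apply: le_trans (Jge v).
  have : (fun n => J (u n) - n.+1%:R^-1) @ \oo --> J w - 0.
    apply: cvgB; last exact: cvg_harmonic.
    apply: cvgB; last exact: continuous_cvg (fc w) uw.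
    by apply: cvgMr_tmp; exact: (cvg_ip ip_norm).
  rewrite subr0 => /cvgr_to_le; apply; near=> n.
  by rewrite lerBlDr ltW.
exists w => h; apply/eqP; rewrite -subr_eq0; apply/eqP.
set d := f h - _.
have [h0|h0] := eqVneq h 0; first by rewrite /d h0 linear0 ip0r subrr.
have hh : 0 < ip h h by rewrite -ip_norm exprn_gt0// normr_gt0.
have fh : f h = d + ip w h by rewrite subrK.
(* This point minimises [J] on the line through [w] directed by [h]; there [J] is smaller than [J w]
   by d^2 / (2 |h|^2), which forces [d] to vanish. *)
have := Jw (w + (d / ip h h) *: h).
rewrite /J fD fZ !ipE (ipC ip h w) fh -subr_ge0.
set D := (X in 0 <= X); have -> : D = - (d ^+ 2 / (2 * ip h h)).
  by rewrite /D; field; rewrite gt_eqF.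
rewrite oppr_ge0 pmulr_lle0 ?invr_gt0 ?mulr_gt0// => d0.
by apply/eqP; rewrite -sqrf_eq0 eq_le sqr_ge0 andbT.
Unshelve. all: by end_near. Qed.

(** [gradient] is a choice by [get]; the Riesz theorem makes the set of candidates nonempty, so the
    chosen vector has the defining property. *)
Lemma gradientE (g : H -> R) x h :
  differentiable g x -> 'd g x h = ip (gradient ip g x) h.
Proof.
move=> dg; have [w wP] := riesz_representation (diff_continuous dg).
have : [set w | forall h, 'd g x h = ip w h] (gradient ip g x).
  by apply: getPex; exists w.
exact.
Qed.

(** The chain rule along a curve, applied below to [g] and to its gradient; the latter produces the
    Hessian term of the equation. *)
Lemma is_derive_comp_diff {W : normedModType R} (F : H -> W) (x : R -> H) (t : R) dx :
  differentiable F (x t) -> is_derive t (1 : R) x dx ->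
  is_derive t (1 : R) (F \o x) ('d F (x t) dx).
Proof.
move=> dF [xd xE].
have dx' : differentiable x t by apply/derivable1_diffP.
apply: DeriveDef; first by apply/derivable1_diffP; exact: differentiable_comp.
rewrite deriveE; last exact: differentiable_comp.
by rewrite diff_comp//= -xE (deriveE _ dx').
Qed.

(** Convexity bounds the difference quotients along the segment from [x] to [z] by g z - g x. Only
    steps in ]0, 1] are covered, hence the passage to the right limit. *)
Lemma convex_gradient_le (g : H -> R) x z :
  convex_function [set: convex_lmodType H] g -> differentiable g x ->
  g x + ip (gradient ip g x) (z - x) <= g z.
Proof.
move=> cg dg; rewrite -gradientE// -deriveE// -lerBrDl.
have dd : derivable g x (z - x) by exact: diff_derivable.
have /cvg_ex[l dl] := dd.
rewrite /derive (cvg_lim _ dl)//.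
have dl' : s^-1 *: (g (s *: (z - x) + x) - g x) @[s --> 0^'+] --> l.
  exact: cvg_dnbhs_at_right dl.
apply: (cvgr_to_le dl'); near=> s.
have s0 : 0 < s by near: s; exact: nbhs_right_gt.
have s1 : s <= 1 by near: s; exact: nbhs_right_le.
have := cg (Itv01 (ltW s0) s1) z x (mem_set I) (mem_set I).
have cE : conv (Itv01 (ltW s0) s1) (z : convex_lmodType H) x =
    s *: z + (1 - s) *: x :> H by [].
have cE' : conv (Itv01 (ltW s0) s1) (g z : R^o) (g x) = s * g z + (1 - s) * g x by [].
rewrite cE cE' => gle.
have -> : s *: (z - x) + x = s *: z + (1 - s) *: x.
  by rewrite scalerBl scale1r scalerBr -addrA [- _ + x]addrC.
rewrite -[X in X <= _]/(s^-1 * (g (s *: z + (1 - s) *: x) - g x)) mulrC.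
rewrite ler_pdivrMr// lerBlDr; apply: le_trans gle _.
by rewrite le_eqVlt; apply/orP; left; apply/eqP; ring.
Unshelve. all: by end_near. Qed.

End Gradient.

(** * Asymptotics of real functions *)

Section RealAnalysis.
Context {R : realType}.
Implicit Types (F f k r : R -> R) (T l L m c t : R).

Lemma is_derive_mull c f t df :
  is_derive t (1 : R) f df -> is_derive t (1 : R) (fun s => c * f s) (c * df).
Proof. by move=> fd; apply: is_deriveZ. Qed.

Lemma is_derive_mul f h t df dh :
  is_derive t (1 : R) f df -> is_derive t (1 : R) h dh ->
  is_derive t (1 : R) (fun s => f s * h s) (f t * dh + h t * df).
Proof. by move=> fd hd; apply: is_deriveM. Qed.

Lemma is_derive_sqr t : is_derive t (1 : R) (fun s : R => s ^+ 2) (2 * t).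
Proof.
have did : is_derive t (1 : R) (fun s : R => s) 1 by exact: is_derive_id.
by apply: is_derive_eq (is_derive_mul did did) _; rewrite mulr1 mulr_natl.
Qed.

Lemma is_derive_le0_nonincreasing F F' T :
  (forall t, T < t -> is_derive t (1 : R) F (F' t)) ->
  (forall t, T < t -> F' t <= 0) ->
  forall s t, T < s -> s <= t -> F t <= F s.
Proof.
move=> dF F'0 s t Ts st.
apply: (@ler0_derive1_nincry _ F s) => //.
- by move=> z; rewrite in_itv/= andbT => sz; have [] := dF z (lt_trans Ts sz).
- move=> z; rewrite in_itv/= andbT => sz; rewrite derive1E.
  by have [_ ->] := dF z (lt_trans Ts sz); exact: F'0 (lt_trans Ts sz).
apply: derivable_within_continuous => z; rewrite in_itv/= andbT => sz.
by have [] := dF z (lt_le_trans Ts sz).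
Qed.

Lemma cvgy_nonincreasing F T m :
  (forall s t, T < s -> s <= t -> F t <= F s) ->
  (forall t, T < t -> m <= F t) -> exists l, F t @[t --> +oo] --> l.
Proof.
(* Freezing the argument below T + 1 makes the function monotone on the whole line, without changing
   it near +oo. *)
move=> ndF mF; pose G t := - F (Num.max t (T + 1)).
have TM t : T < Num.max t (T + 1) by rewrite lt_max ltrDl ltr01 orbT.
have Gnd : nondecreasing_fun G.
  move=> s t st; rewrite lerN2; apply: ndF => //.
  by rewrite ge_max !le_max st lexx orbT.
have Gub : has_ubound (range G).
  by exists (- m) => _ [t _ <-]; rewrite lerN2; exact: mF.
exists (- sup (range G)).
apply: cvg_trans (cvgN (nondecreasing_cvgr Gnd Gub)).
apply: near_eq_cvg; near=> t; rewrite /G /= opprK.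
have Tt : T + 1 <= t by near: t; exact: nbhs_pinfty_ge (num_real _).
by rewrite max_l.
Unshelve. all: by end_near. Qed.

Lemma is_derive_ge0_cvgy F f a M :
  (forall t, a < t -> is_derive t (1 : R) F (f t)) ->
  (forall t, a < t -> 0 <= f t) ->
  (forall t, a < t -> F t <= M) -> exists l, F t @[t --> +oo] --> l.
Proof.
move=> dF f0 FM.
have [l Fl] : exists l, - F t @[t --> +oo] --> l.
  apply: (@cvgy_nonincreasing _ a (- M)); last by move=> t /FM; rewrite lerN2.
  apply: (@is_derive_le0_nonincreasing _ (fun t => - f t)).
    by move=> t /dF ?; exact: is_deriveN.
  by move=> t at_; rewrite oppr_le0 f0.
exists (- l); have -> : F = (fun t => - (- F t)) by apply/funext => t; rewrite opprK.
exact: cvgN.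
Qed.

(** F + c N is nonincreasing beyond [T] and [F] is bounded below, so [N] is bounded above there;
    before that point [N] is controlled by its own monotonicity. *)
Lemma dissipated_primitive_le F F' f N a T m c :
  (forall t, T < t -> is_derive t (1 : R) F (F' t)) ->
  (forall t, T < t -> F' t <= - (c * f t)) ->
  (forall t, T < t -> m <= F t) -> 0 < c -> a <= T ->
  (forall t, a < t -> is_derive t (1 : R) N (f t)) ->
  (forall t, a < t -> 0 <= f t) ->
  exists M, forall t, a < t -> N t <= M.
Proof.
move=> dF F'le mF c0 aT dN f0.
have FN : forall s t, T < s -> s <= t -> F t + c * N t <= F s + c * N s.
  apply: (@is_derive_le0_nonincreasing _ (fun t => F' t + c * f t)).
    move=> t Tt; apply: is_deriveD; first exact: dF.
    by apply: is_deriveZ; apply: dN; exact: le_lt_trans Tt.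
  by move=> t /F'le; rewrite -lerBrDr sub0r.
have Nni : forall s t, a < s -> s <= t -> - N t <= - N s.
  apply: (@is_derive_le0_nonincreasing _ (fun t => - f t)).
    by move=> t at_; apply: is_deriveN; exact: dN.
  by move=> t at_; rewrite oppr_le0 f0.
have TS : T < T + 1 by rewrite ltrDl.
exists (Num.max (N (T + 1)) ((F (T + 1) + c * N (T + 1) - m) / c)) => t at_.
rewrite le_max; apply/orP; have [tS|/ltW St] := leP t (T + 1).
  by left; rewrite -lerN2; exact: Nni.
right; rewrite ler_pdivlMr// mulrC lerBrDr; apply: le_trans (FN _ _ TS St).
by rewrite addrC lerD2r mF// (lt_le_trans TS).
Qed.

(* Otherwise F + d ln t would be eventually nonincreasing for some d > 0. *)
Lemma log_decay_limit_le0 F F' r T m c l :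
  (forall t, T < t -> is_derive t (1 : R) F (F' t)) ->
  0 < c -> (forall t, T < t -> F' t <= - (c * (r t / t))) ->
  (forall t, T < t -> m <= F t) -> r t @[t --> +oo] --> l -> l <= 0.
Proof.
move=> dF c0 F'le mF rl; rewrite leNgt; apply/negP => l0.
have [S [_ rS]] : \forall t \near (pinfty_nbhs R), l / 2 < r t.
  by apply: (cvgr_gt _ rl); rewrite ltr_pdivrMr// ltr_pMr// ltr1n.
pose T1 := Num.max (Num.max T S) 1.
have TT1 t : T1 < t -> [/\ T < t, S < t & 1 < t].
  by rewrite /T1 !gt_max => /andP[/andP[-> ->] ->].
pose d := c * (l / 2).
have d0 : 0 < d by rewrite mulr_gt0// divr_gt0.
have nd : forall s t, T1 < s -> s <= t -> F t + d * ln t <= F s + d * ln s.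
  apply: (@is_derive_le0_nonincreasing _ (fun t => F' t + d * t^-1)).
    move=> t /TT1[Tt _ t1]; apply: is_deriveD; first exact: dF.
    by apply: is_deriveZ; apply: is_derive1_ln; exact: lt_trans t1.
  move=> t /TT1[Tt St t1]; have t0 : 0 < t by exact: lt_trans t1.
  rewrite -lerBrDr sub0r; apply: le_trans (F'le _ Tt) _; rewrite lerN2.
  rewrite /d -mulrA ler_pM2l// ler_pM2r ?invr_gt0//; exact: ltW (rS _ St).
pose s := T1 + 1; have T1s : T1 < s by rewrite ltrDl.
(* Chosen so that d ln t exceeds F s + d ln s - m; the added 1 makes the contradiction strict. *)
pose t := Num.max s (expR ((F s + d * ln s - m) / d + 1)).
have st : s <= t by rewrite le_max lexx.
have := nd s t T1s st; apply/negP; rewrite -ltNge.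
have mt : m <= F t by apply: mF; have [] := TT1 _ (lt_le_trans T1s st).
apply: lt_le_trans (_ : m + d * ln t <= _); last by rewrite lerD2r.
have : (F s + d * ln s - m) / d + 1 <= ln t.
  rewrite -[leLHS]expRK ler_ln ?posrE ?expR_gt0//.
    by rewrite le_max lexx orbT.
  by rewrite lt_max expR_gt0 orbT.
rewrite -(ler_pM2l d0) mulrDr mulr1 mulrCA divff ?gt_eqF// mulr1.
by move=> h; rewrite -ltrBlDl; apply: lt_le_trans h; rewrite ltrDl.
Qed.

(** The upper half of [ode_cvg]. Of the margin [e], one half enters the threshold [A] and the other
    absorbs W s / t^c, which tends to 0. *)
Lemma ode_limsup_le k k' T c L :
  0 < c -> (forall t, T < t -> is_derive t (1 : R) k (k' t)) ->
  t * k' t + c * k t @[t --> +oo] --> L ->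
  forall e, 0 < e -> \forall t \near (pinfty_nbhs R), k t <= L / c + e.
Proof.
move=> c0 dk kL e e0.
have [S [_ kS]] : \forall t \near (pinfty_nbhs R), t * k' t + c * k t < L + c * (e / 2).
  by apply: (cvgr_lt _ kL); rewrite ltrDl mulr_gt0// divr_gt0.
pose T1 := Num.max (Num.max T S) 1.
have TT1 t : T1 < t -> [/\ T < t, S < t & 1 < t].
  by rewrite /T1 !gt_max => /andP[/andP[-> ->] ->].
pose A := L / c + e / 2.
(* W = t^c (k - A), by the integrating factor t^c of t k' + c k. *)
pose W t := expR (c * ln t) * (k t - A).
have ni : forall s t, T1 < s -> s <= t -> W t <= W s.
  apply: (@is_derive_le0_nonincreasing _
    (fun t => expR (c * ln t) * k' t + (k t - A) * (expR (c * ln t) * (c * t^-1)))).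
    move=> t /TT1[Tt _ t1].
    have h1 : is_derive t (1 : R) (fun t => expR (c * ln t)) (expR (c * ln t) * (c * t^-1)).
      apply: (@is_derive1_comp _ expR (fun t => c * ln t)).
      by apply: is_deriveZ; apply: is_derive1_ln; exact: lt_trans t1.
    have h2 : is_derive t (1 : R) (fun t => k t - A) (k' t).
      rewrite -[X in is_derive _ _ _ X]subr0; apply: is_deriveB; exact: dk.
    exact: is_deriveM.
  move=> t /TT1[Tt St t1]; have t0 : 0 < t by exact: lt_trans t1.
  have -> : expR (c * ln t) * k' t + (k t - A) * (expR (c * ln t) * (c * t^-1)) =
      expR (c * ln t) / t * (t * k' t + c * k t - (L + c * (e / 2))).
    by rewrite /A; field; rewrite !gt_eqF.
  rewrite pmulr_rle0 ?divr_gt0 ?expR_gt0// subr_le0; exact: ltW (kS _ St).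
pose s := T1 + 1; have T1s : T1 < s by rewrite ltrDl.
have s0 : 0 < s by have [_ _] := TT1 _ T1s; exact: lt_trans.
near=> t.
have st : s <= t by near: t; exact: nbhs_pinfty_ge (num_real _).
have := ni s t T1s st; rewrite {1}/W => Wts.
have Ep : 0 < expR (c * ln t) by exact: expR_gt0.
suff Wse : W s <= expR (c * ln t) * (e / 2).
  have := le_trans Wts Wse; rewrite ler_pM2l// lerBlDr /A => /le_trans; apply.
  by rewrite addrCA -splitr.
have [Ws0|Ws0] := leP (W s) 0.
  by apply: le_trans Ws0 _; rewrite mulr_ge0// ltW// divr_gt0.
rewrite -ler_pdivrMr ?divr_gt0//.
have We : 0 < W s / (e / 2) by rewrite !divr_gt0.
rewrite -[leLHS]lnK ?posrE// ler_expR -ler_pdivrMl//.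
have t0 : 0 < t by exact: lt_le_trans st.
(* The left-hand side is (2 W s / e)^(1/c), the point from which W s <= t^c e/2. *)
have Et : expR (c^-1 * ln (W s / (e / 2))) <= t.
  by near: t; exact: nbhs_pinfty_ge (num_real _).
by rewrite -[leLHS]expRK ler_ln ?posrE ?expR_gt0.
Unshelve. all: by end_near. Qed.

(** The one-sided estimate is used for [k] and for - k. *)
Lemma ode_cvg k k' T c L :
  0 < c -> (forall t, T < t -> is_derive t (1 : R) k (k' t)) ->
  t * k' t + c * k t @[t --> +oo] --> L -> k t @[t --> +oo] --> L / c.
Proof.
move=> c0 dk kL; apply/cvgrPdist_le => e e0.
have up := ode_limsup_le c0 dk kL e0.
have dNk t : T < t -> is_derive t (1 : R) (fun s => - k s) (- k' t).
  by move=> Tt; apply: is_deriveN; exact: dk.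
have NkL : t * - k' t + c * - k t @[t --> +oo] --> - L.
  have -> : (fun t => t * - k' t + c * - k t) = (fun t => - (t * k' t + c * k t)).
    by apply/funext => t; ring.
  exact: cvgN.
have lo := ode_limsup_le c0 dNk NkL e0.
near=> t; rewrite ler_distlC.
have h1 : k t <= L / c + e by near: t.
have h2 : - k t <= - L / c + e by near: t.
by apply/andP; split=> //; rewrite -lerN2 opprB addrC -mulNr.
Unshelve. all: by end_near. Qed.

(** Continuity at the left endpoint is recorded too, because the fundamental theorem on the
    half-line needs the boundary value F a. *)
Lemma continuous_primitive f a :
  {within `[a, +oo[, continuous f} ->
  let F t := (\int[lebesgue_measure]_(s in `[a, t]) f s)%R in
  (forall t, a < t -> is_derive t (1 : R) F (f t)) /\
  F t @[t --> a^'+] --> F a.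
Proof.
move=> cf F.
have fi u : lebesgue_measure.-integrable `[a, u] (EFin \o f).
  apply: continuous_compact_integrable; first exact: segment_compact.
  by apply: continuous_subspaceW cf; exact: subset_itvl.
have cft t : a < t -> {for t, continuous f}.
  move=> at_; have /continuous_within_itvcyP[+ _] := cf; apply.
  by rewrite in_itv/= at_.
split.
- move=> t at_.
  have tt1 : t < t + 1 by rewrite ltrDl.
  have [d dE] := continuous_FTC1_closed tt1 (fi _) at_ (cft _ at_).
  by apply: DeriveDef; [exact: d|rewrite -derive1E; exact: dE].
- have a1 : a < a + 1 by rewrite ltrDl.
  rewrite {2}/F set_itv1 Rintegral_set1; apply: cvg_at_right_filter.
  exact: parameterized_integral_cvg_left a1 (fi _).
Qed.

(** The primitive is monotone and bounded, so it has a limit [l], and the integral of [f] equals the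
    finite number l - F a. *)
Lemma bounded_primitive_integrable f F a M :
  {within `[a, +oo[, continuous f} -> (forall t, a <= t -> 0 <= f t) ->
  (forall t, a < t -> is_derive t (1 : R) F (f t)) ->
  F t @[t --> a^'+] --> F a -> (forall t, a < t -> F t <= M) ->
  lebesgue_measure.-integrable `[a, +oo[ (EFin \o f).
Proof.
move=> cf f0 dF Fa FM.
have [l Fl] : exists l, F t @[t --> +oo] --> l.
  by apply: is_derive_ge0_cvgy dF _ FM => t /ltW; exact: f0.
have mf : measurable_fun `[a, +oo[ f.
  exact: subspace_continuous_measurable_fun.
apply/integrableP; split; first exact/measurable_EFinP.
under eq_integral => t ta.
  rewrite gee0_abs; last first.
    by move: ta; rewrite inE/= in_itv/= andbT lee_fin; exact: f0.
  over.
rewrite (@ge0_continuous_FTC2y _ f F a l)// ?ltry//.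
- by move=> t /dF[].
- by move=> t; rewrite in_itv/= andbT => /dF[dFt Ft]; rewrite derive1E.
Qed.

Lemma finite_integral_primitive_le f a :
  {within `[a, +oo[, continuous f} -> (forall t, a <= t -> 0 <= f t) ->
  (\int[lebesgue_measure]_(t in `[a, +oo[) (f t)%:E < +oo)%E ->
  exists M, forall t, (\int[lebesgue_measure]_(s in `[a, t]) f s)%R <= M.
Proof.
move=> cf f0 ioo; pose mu := @lebesgue_measure R.
have mf : measurable_fun `[a, +oo[ f.
  exact: subspace_continuous_measurable_fun.
have i0 (b : itv_bound R) : (0 <= \int[mu]_(t in [set` Interval (BLeft a) b]) (f t)%:E)%E.
  by apply: integral_ge0 => t /=; rewrite itv_boundlr => /andP[at_ _]; rewrite lee_fin f0.
have ile t : (\int[mu]_(s in `[a, t]) (f s)%:E <= \int[mu]_(s in `[a, +oo[) (f s)%:E)%E.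
  apply: ge0_subset_integral => //.
  - exact/measurable_EFinP.
  - by move=> s /=; rewrite in_itv/= andbT lee_fin; exact: f0.
  - exact: subset_itvl.
exists (fine (\int[mu]_(t in `[a, +oo[) (f t)%:E)%E) => t.
rewrite /Rintegral fine_le// ge0_fin_numE//.
exact: le_lt_trans ioo.
Qed.

End RealAnalysis.

(** * One-sided derivatives *)

Section DerivativeOnHalfLine.
Context {R : realType} {V : normedModType R}.
Implicit Types (f : R -> V) (a t : R).

(** At an interior point the constraint to the half-line holds in a whole neighbourhood, so it does
    not affect the limit. *)
Lemma is_derive_derive_in f a t : a < t -> derivable_in `[a, +oo[ f t ->
  is_derive t (1 : R) f (derive_in `[a, +oo[ f t).
Proof.
move=> at_ /cvg_ex[l fl].
have tl : diff_quotient f t s @[s --> t^'] --> l.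
  apply: cvg_trans fl; apply: cvg_app => P; rewrite /within/dnbhs/=.
  apply: filterS2 (lt_nbhsr at_) => s as_ + st; apply => //.
  by rewrite /= in_itv/= andbT ltW.
have st : s + t @[s --> (0 : R)^'] --> t^'.
  move=> P [e/= e0 eP]; exists e => // s; rewrite /ball_/= sub0r normrN => se s0.
  apply: eP; first by rewrite /ball_/= opprD addrCA subrr addr0 normrN.
  by rewrite -subr_eq0 addrK.
have dq : s^-1 *: (f (s *: (1 : R) + t) - f t) @[s --> 0^'] --> l.
  have -> : (fun s => s^-1 *: (f (s *: (1 : R) + t) - f t)) =
      diff_quotient f t \o (fun s => s + t).
    by apply/funext => s; rewrite /diff_quotient/= addrK [s *: _]mulr1.
  exact: cvg_comp st tl.
(* Properness makes the limit unique, which identifies the [lim] in [derive_in] with [l]. *)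
have wP : ProperFilter (within `[a, +oo[ t^').
  apply: Build_ProperFilter_ex => P.
  have : t^' --> within `[a, +oo[ t^'.
    move=> Q; rewrite /within/dnbhs/=.
    apply: filterS2 (lt_nbhsr at_) => s as_ + st'; apply => //.
    by rewrite /= in_itv/= andbT ltW.
  by move=> /(_ P) tw wP; have /filter_ex := tw wP.
apply: DeriveDef; first by apply/cvg_ex; exists l.
by rewrite /derive_in (cvg_lim _ fl)//; exact: cvg_lim.
Qed.

(** Interior points are covered by the two-sided derivative; at the endpoint f s = (s - a) q(s) + f
    a with a convergent quotient q. *)
Lemma derivable_in_within_continuous f a :
  (forall t, a <= t -> derivable_in `[a, +oo[ f t) ->
  {within `[a, +oo[, continuous f}.
Proof.
move=> df; apply/continuous_within_itvcyP; split.
  move=> t; rewrite in_itv/= andbT => at_.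
  apply: differentiable_continuous; apply/derivable1_diffP.
  by have [] := is_derive_derive_in at_ (df _ (ltW at_)).
have /cvg_ex[l fl] := df a (lexx a).
have al : diff_quotient f a s @[s --> a^'+] --> l.
  apply: cvg_trans fl; apply: cvg_app => P.
  suff : (\forall s \near a, s != a -> `[a, +oo[%classic s -> P s) ->
      \forall s \near a, a < s -> P s by [].
  apply: filterS => s + as_; apply; first by rewrite gt_eqF.
  by rewrite /= in_itv/= andbT ltW.
have : (s - a) *: diff_quotient f a s + f a @[s --> a^'+] --> (a - a) *: l + f a.
  apply: cvgD; last exact: cvg_cst.
  apply: cvgZ => //; apply: cvgB; last exact: cvg_cst.
  by apply: cvg_at_right_filter; exact: cvg_id.
rewrite subrr scale0r add0r; apply: cvg_trans; apply: near_eq_cvg; near=> s.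
have as_ : a < s by near: s; exact: nbhs_right_gt.
by rewrite /diff_quotient scalerA divff ?subr_eq0 ?gt_eqF// scale1r subrK.
Unshelve. all: by end_near. Qed.

End DerivativeOnHalfLine.

(** * Energy estimates *)

Section TikhonovHessian.
Context {R : realType} {H : completeNormedModType R}.
Context (ip : {dot H for (@idfun R)}) (ip_norm : inner_product_norm ip).
Context (t0 : R) (t0_gt0 : 0 < t0) (g : H -> R).
Context (g_convex : convex_function [set: convex_lmodType H] g).
Context (g_diff2 : twice_differentiable ip g).
Context (eps : R -> R) (eps_ge0 : forall t, t0 <= t -> 0 <= eps t).
Context (eps_noninc : forall s t, t0 <= s -> s <= t -> eps t <= eps s).
Context (eps_C1 : C1_on `[t0, +oo[ eps).
Context (alpha beta : R) (beta_ge0 : 0 <= beta) (u0 v0 : H) (x : R -> H).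
Context (x_sol : tikhonov_hessian_solution ip g eps alpha beta t0 u0 v0 x).
Context (xstar : H) (xstar_min : argmin g xstar).
Implicit Types (t b c : R).

Definition velocity t := derive_in `[t0, +oo[ x t.
Definition grad t := gradient ip g (x t).
Definition dist t := x t - xstar.
Definition damped_velocity t := velocity t + beta *: grad t.
Definition gap t := g (x t) - g xstar.
Definition eps' t := derive_in `[t0, +oo[ eps t.

Local Notation y := dist.
Local Notation D := grad.
Local Notation v := damped_velocity.
Local Notation x' := velocity.
Local Notation G := gap.

(** * Derivatives along the trajectory *)

Lemma is_derive_solution t : t0 < t -> is_derive t (1 : R) x (x' t).
Proof.
move=> t0t; apply: is_derive_derive_in => //.
by have [[[+ _] _] _ _ _] := x_sol; apply; rewrite /= in_itv/= andbT ltW.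
Qed.

Lemma is_derive_eps t : t0 < t -> is_derive t (1 : R) eps (eps' t).
Proof.
move=> t0t; apply: is_derive_derive_in => //.
by have [+ _] := eps_C1; apply; rewrite /= in_itv/= andbT ltW.
Qed.

Lemma eps'_le0 t : t0 < t -> eps' t <= 0.
Proof.
move=> t0t; have [de <-] := is_derive_eps t0t.
have /cvg_ex[l el] := de; rewrite /derive (cvg_lim _ el)//.
apply: (cvgr_to_le (cvg_dnbhs_at_right el)); near=> h.
have h0 : 0 < h by near: h; exact: nbhs_right_gt.
apply: mulr_ge0_le0; first by rewrite invr_ge0 ltW.
rewrite subr_le0 /= eps_noninc ?(ltW t0t)// lerDr.
by apply: mulr_ge0 => //; exact: ltW.
Unshelve. all: by end_near. Qed.

Lemma is_derive_dist t : t0 < t -> is_derive t (1 : R) y (x' t).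
Proof.
move=> t0t; rewrite -[x' t]subr0; apply: is_deriveB; exact: is_derive_solution.
Qed.

Lemma is_derive_gap t : t0 < t -> is_derive t (1 : R) G (ip (D t) (x' t)).
Proof.
move=> t0t; rewrite -[X in is_derive _ _ _ X]subr0; apply: is_deriveB.
rewrite -gradientE; [|exact: ip_norm|exact: g_diff2.1].
by apply: (is_derive_comp_diff (g_diff2.1 _)); exact: is_derive_solution.
Qed.

(** The Hessian term of the equation is exactly the derivative of beta D, so it disappears from
    v'. *)
Lemma is_derive_damped_velocity t : t0 < t ->
  is_derive t (1 : R) v (- ((alpha / t) *: x' t + D t + eps t *: x t)).
Proof.
move=> t0t.
have dv : is_derive t (1 : R) v
    (derive_in `[t0, +oo[ x' t + beta *: hessian ip g (x t) (x' t)).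
  apply: is_deriveD.
    apply: is_derive_derive_in => //.
    by have [[_ [+ _]] _ _ _] := x_sol; apply; rewrite /= in_itv/= andbT ltW.
  apply: is_deriveZ.
  by apply: (is_derive_comp_diff (g_diff2.2 _)); exact: is_derive_solution.
apply: is_derive_eq dv _; have [_ + _ _] := x_sol.
move=> /(_ t (ltW t0t)); rewrite -/(velocity t) => xE.
apply/eqP; rewrite -subr_eq0 opprK -xE; apply/eqP.
by rewrite /velocity /grad !addrA; congr (_ + _ + _); rewrite addrAC.
Qed.

Lemma gap_ge0 t : 0 <= G t.
Proof. by rewrite subr_ge0 xstar_min. Qed.

(** The gradient inequality at x t, tested at [xstar]. With [gap_ge0] it also yields <y, D> >= 0. *)
Lemma gap_le t : G t <= ip (y t) (D t).
Proof.
have := convex_gradient_le ip_norm xstar g_convex (g_diff2.1 (x t)).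
rewrite -(opprB (x t) xstar) ipNr (ipC ip) /gap /dist /grad.
by move: (ip _ _) => a; lra.
Qed.

Lemma dist_gradE t : ip (y t) (D t) = ip (x t) (D t) - ip xstar (D t).
Proof. by rewrite ipDl ipNl. Qed.

(** In the notation of the overview, [linear_energy] is p, [main_energy] is r and [quadratic_energy]
    is q. *)
Definition linear_energy t :=
  - (beta * (t * G t)) + t * ip (y t) (v t) + (alpha - 1) / 2 * ip (y t) (y t).

Definition main_energy t :=
  t ^+ 2 * G t + t ^+ 2 * (eps t / 2 * ip (x t) (x t)) + t ^+ 2 / 2 * ip (v t) (v t).

Definition quadratic_energy t := main_energy t + beta * (alpha - 2) * (t * G t).

(** The derivative after substitution of the equation: the weight (alpha - 1)/2 in p removes <y,
    x'>, and - beta t G removes <D, x'>. *)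
Definition linear_energy' t :=
  - (beta * G t) + beta * ip (y t) (D t) + t * ip (x' t) (x' t)
  - t * ip (y t) (D t) - t * (eps t * ip (y t) (x t)).

(** The derivative after substitution of the equation: r' leaves beta (2 - alpha) t <D, x'>, which
    the additional term beta (alpha - 2) t G of q cancels. *)
Definition quadratic_energy' t :=
  (2 * t + beta * (alpha - 2)) * G t
  + (t * eps t + t ^+ 2 * eps' t / 2) * ip (x t) (x t)
  + (1 - alpha) * t * ip (x' t) (x' t)
  + beta * (beta * t - t ^+ 2) * ip (D t) (D t)
  - t ^+ 2 * eps t * beta * ip (D t) (x t).

Lemma is_derive_linear_energy t : t0 < t ->
  is_derive t (1 : R) linear_energy (linear_energy' t).
Proof.
move=> t0t; have t_neq0 : t != 0 by rewrite gt_eqF// (lt_trans t0_gt0).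
have dG := is_derive_gap t0t; have dy := is_derive_dist t0t.
have dv := is_derive_damped_velocity t0t.
have did : is_derive t (1 : R) (fun s : R => s) 1 by exact: is_derive_id.
have d1 := is_derive_mull beta (is_derive_mul did dG).
have d2 := is_derive_mul did (is_derive_ip ip_norm dy dv).
have d3 := is_derive_mull ((alpha - 1) / 2) (is_derive_ip ip_norm dy dy).
apply: is_derive_eq (is_deriveD (is_deriveD (is_deriveN d1) d2) d3) _.
rewrite /linear_energy' /damped_velocity; move: (y t) => z; rewrite !ipE.
rewrite (ipC ip (x' t) z) (ipC ip (D t) (x' t)).
by field.
Qed.

Lemma is_derive_quadratic_energy t : t0 < t ->
  is_derive t (1 : R) quadratic_energy (quadratic_energy' t).
Proof.
move=> t0t; have t_neq0 : t != 0 by rewrite gt_eqF// (lt_trans t0_gt0).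
have dG := is_derive_gap t0t; have dx := is_derive_solution t0t.
have dv := is_derive_damped_velocity t0t; have de := is_derive_eps t0t.
have did : is_derive t (1 : R) (fun s : R => s) 1 by exact: is_derive_id.
have dsq := is_derive_sqr t.
have d1 := is_derive_mul dsq dG.
have de2 : is_derive t (1 : R) (fun s => eps s / 2) (eps' t / 2).
  have -> : (fun s => eps s / 2) = (fun s => 2^-1 * eps s).
    by apply/funext => s; rewrite mulrC.
  by rewrite mulrC; exact: is_derive_mull.
have d2 := is_derive_mul dsq (is_derive_mul de2 (is_derive_ip ip_norm dx dx)).
have dsq2 : is_derive t (1 : R) (fun s : R => s ^+ 2 / 2) (2^-1 * (2 * t)).
  have -> : (fun s : R => s ^+ 2 / 2) = (fun s => 2^-1 * s ^+ 2).
    by apply/funext => s; rewrite mulrC.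
  exact: is_derive_mull.
have d3 := is_derive_mul dsq2 (is_derive_ip ip_norm dv dv).
have d4 := is_derive_mull (beta * (alpha - 2)) (is_derive_mul did dG).
apply: is_derive_eq (is_deriveD (is_deriveD (is_deriveD d1 d2) d3) d4) _.
rewrite /quadratic_energy' /damped_velocity !ipE.
rewrite (ipC ip (x t) (x' t)) (ipC ip (D t) (x' t)) (ipC ip (x t) (D t)).
by field.
Qed.

(** Completing the square as |b y + t v|^2 / 2 leaves multiples of G, eps |x|^2 and |y|^2; the
    hypotheses on [b] and [t] make their coefficients nonnegative. *)
Lemma energy_ge0 b t : t0 <= t -> 0 <= b -> b <= alpha - 1 ->
  beta * (b + 2 - alpha) <= t -> 0 <= quadratic_energy t + b * linear_energy t.
Proof.
move=> t0t b0 ba tb; have t_ge0 : 0 <= t by rewrite (le_trans _ t0t)// ltW.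
rewrite (_ : _ + _ = t * (t - beta * (b + 2 - alpha)) * G t
    + t ^+ 2 * (eps t / 2 * ip (x t) (x t))
    + ip (b *: y t + t *: v t) (b *: y t + t *: v t) / 2
    + b * (alpha - 1 - b) / 2 * ip (y t) (y t)).
  have xx := ip_ge0 ip_norm (x t); have yy := ip_ge0 ip_norm (y t).
  have ww := ip_ge0 ip_norm (b *: y t + t *: v t).
  have G0 := gap_ge0 t; have e0 := eps_ge0 t0t.
  have tb' : 0 <= t - beta * (b + 2 - alpha) by rewrite subr_ge0.
  have ab' : 0 <= alpha - 1 - b by rewrite subr_ge0.
  by rewrite !addr_ge0 ?mulr_ge0 ?exprn_ge0 ?invr_ge0.
rewrite /quadratic_energy /main_energy /linear_energy.
move: (y t) (v t) => z w; rewrite !ipE (ipC ip w z).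
by field.
Qed.

(** * Dissipation of the energies *)

Ltac nonneg := repeat first [assumption | exact: sqr_ge0 | exact: ler0n
  | rewrite invr_ge0 | apply: addr_ge0 | apply: mulr_ge0].

Definition dissipation t :=
  t * ip (y t) (D t) + t * ip (x' t) (x' t) + t * (eps t * ip (x t) (x t))
  + beta * (t ^+ 2 * ip (D t) (D t)).

(* Young's inequality, through |2 D + a eps x|^2 >= 0 in case (a), and through
   |D + eps xstar|^2 >= 0 and t eps <= a in case (b). *)
Lemma cross_term_le :
  (exists a t1 : R, [/\ 1 < a, t0 <= t1 &
     forall t, t1 <= t -> eps' t <= - (a * beta / 2) * eps t ^+ 2]) \/
  (exists a t1 : R, [/\ 0 < a, t0 <= t1 & forall t, t1 <= t -> eps t <= a / t]) ->
  exists kappa C : R, [/\ 0 < kappa, 0 <= C & \forall t \near pinfty_nbhs R,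
    t ^+ 2 * eps' t / 2 * ip (x t) (x t) - t ^+ 2 * eps t * beta * ip (D t) (x t)
      - beta * t ^+ 2 * ip (D t) (D t) <=
    C * (t * eps t) - kappa * beta * (t ^+ 2 * ip (D t) (D t))].
Proof.
case=> [[a [t1 [a1 t01 epsa]]]|[a [t1 [a0 t01 epsa]]]].
- have a0 : 0 < a by rewrite (lt_trans ltr01).
  (* The square, taken with weight beta / (4 a), uses up beta / a of the available beta |D|^2. *)
  exists (1 - a^-1), 0; split=> //; first by rewrite subr_gt0 invf_lt1.
  near=> t.
  have t1t : t1 <= t by near: t; exact: nbhs_pinfty_ge (num_real _).
  have e'le := epsa _ t1t.
  have xx := ip_ge0 ip_norm (x t).
  have N := ip_ge0 ip_norm (2 *: D t + (a * eps t) *: x t).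
  rewrite -subr_ge0 (_ : _ - _ = t ^+ 2 *
    ((- (a * beta / 2) * eps t ^+ 2 - eps' t) / 2 * ip (x t) (x t)
     + beta / (4 * a) * ip (2 *: D t + (a * eps t) *: x t) (2 *: D t + (a * eps t) *: x t))).
    rewrite -subr_ge0 in e'le.
    by rewrite mulr_ge0 ?sqr_ge0// addr_ge0// mulr_ge0// divr_ge0// mulr_ge0// ltW.
  by rewrite !ipE (ipC ip (x t) (D t)); field; rewrite gt_eqF.
- pose ss := ip xstar xstar.
  have ss0 : 0 <= ss by exact: ip_ge0.
  (* With x = y + xstar, the part eps <D, y> has a favourable sign, and eps <D, xstar> costs half of
     |D|^2 plus eps^2 ss / 2, where t^2 eps^2 <= a t eps. *)
  exists 2^-1, (beta * a / 2 * ss); split; first by rewrite invr_gt0.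
    by rewrite mulr_ge0// divr_ge0// mulr_ge0// ltW.
  near=> t.
  have t1t : t1 <= t by near: t; exact: nbhs_pinfty_ge (num_real _).
  have t0t : t0 < t by near: t; exact: nbhs_pinfty_gt (num_real _).
  have t_gt0 : 0 < t by exact: lt_trans t0t.
  have ea : 0 <= a - t * eps t.
    by rewrite subr_ge0 mulrC -ler_pdivlMr// epsa.
  have e0 := eps_ge0 (ltW t0t).
  have e'le : 0 <= - eps' t by rewrite oppr_ge0 eps'_le0.
  have xx := ip_ge0 ip_norm (x t).
  have yD : 0 <= ip (y t) (D t) by rewrite (le_trans (gap_ge0 t))// gap_le.
  have N := ip_ge0 ip_norm (D t + eps t *: xstar).
  rewrite -subr_ge0 (_ : _ - _ = t ^+ 2 * (- eps' t / 2 * ip (x t) (x t)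
      + eps t * beta * ip (y t) (D t)
      + beta / 2 * ip (D t + eps t *: xstar) (D t + eps t *: xstar))
      + beta / 2 * ss * (t * eps t * (a - t * eps t))).
    have t_ge0 := ltW t_gt0.
    by nonneg.
  rewrite dist_gradE /ss !ipE (ipC ip (x t) (D t)) (ipC ip xstar (D t)). field.
Unshelve. all: by end_near. Qed.

(** As G <= <y, D>, the term 2 t G is beaten by b t <y, D> when b > 2, while b < alpha - 1 keeps the
    coefficient of t |x'|^2 negative. Polarising <y, x> leaves an error b/2 |xstar|^2 t eps. *)
Lemma energy_dissipation (kappa C0 b : R) :
  0 < kappa -> 0 <= C0 ->
  (\forall t \near pinfty_nbhs R,
    t ^+ 2 * eps' t / 2 * ip (x t) (x t) - t ^+ 2 * eps t * beta * ip (D t) (x t)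
      - beta * t ^+ 2 * ip (D t) (D t) <=
    C0 * (t * eps t) - kappa * beta * (t ^+ 2 * ip (D t) (D t))) ->
  2 < b -> b < alpha - 1 ->
  exists c C : R, [/\ 0 < c, 0 <= C & \forall t \near pinfty_nbhs R,
    quadratic_energy' t + b * linear_energy' t <= C * (t * eps t) - c * dissipation t].
Proof.
move=> kappa0 C00 cross b2 ba; pose ss := ip xstar xstar.
have ss0 : 0 <= ss by exact: ip_ge0.
pose c := Num.min (Num.min ((b - 2) / 2) (alpha - 1 - b)) (kappa / 2).
have b20 : 0 < b - 2 by rewrite subr_gt0.
have c0 : 0 < c by rewrite !lt_min (divr_gt0 b20)// (divr_gt0 kappa0)// subr_gt0 ba.
have [cb ca ck] : [/\ c <= (b - 2) / 2, c <= alpha - 1 - b & c <= kappa / 2].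
  by rewrite /c !ge_min !lexx !orbT.
exists c, (C0 + b / 2 * ss); split=> //.
  by rewrite addr_ge0// mulr_ge0// divr_ge0// ltW// (lt_trans _ b2).
(* The coefficient of G in q' + b p' is 2 t + K. *)
pose K := beta * (alpha - 2 - b).
near=> t.
have t0t : t0 < t by near: t; exact: nbhs_pinfty_gt (num_real _).
have t_gt0 : 0 < t by exact: lt_trans t0t.
have hK : 0 <= 2 * t + K.
  have : - K / 2 <= t by near: t; exact: nbhs_pinfty_ge (num_real _).
  lra.
have hb : 0 <= (b - 2) / 2 * t - K - b * beta.
  have : (K + b * beta) / ((b - 2) / 2) <= t.
    by near: t; exact: nbhs_pinfty_ge (num_real _).
  by rewrite ler_pdivrMr ?divr_gt0//; lra.
have hk : 0 <= kappa / 2 * t - beta.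
  have : beta / (kappa / 2) <= t by near: t; exact: nbhs_pinfty_ge (num_real _).
  by rewrite ler_pdivrMr ?divr_gt0//; lra.
have cr : 0 <= C0 * (t * eps t) - kappa * beta * (t ^+ 2 * ip (D t) (D t)) -
    (t ^+ 2 * eps' t / 2 * ip (x t) (x t) - t ^+ 2 * eps t * beta * ip (D t) (x t)
      - beta * t ^+ 2 * ip (D t) (D t)) by rewrite subr_ge0; near: t.
have e0 := eps_ge0 (ltW t0t).
have xx := ip_ge0 ip_norm (x t); have yy := ip_ge0 ip_norm (y t).
have vv := ip_ge0 ip_norm (x' t); have DD := ip_ge0 ip_norm (D t).
have yG : 0 <= ip (y t) (D t) - G t by rewrite subr_ge0 gap_le.
have yD : 0 <= ip (y t) (D t) by rewrite (le_trans (gap_ge0 t))// gap_le.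
have t_ge0 := ltW t_gt0; have b_ge0 : 0 <= b by rewrite ltW// (lt_trans _ b2).
have hb' : 0 <= (b - 2) * t - K - b * beta - c * t.
  have : c * t <= (b - 2) / 2 * t by rewrite ler_pM2r.
  lra.
have hk' : 0 <= t * (kappa * t - beta - c * t).
  rewrite mulr_ge0//; have : c * t <= kappa / 2 * t by rewrite ler_pM2r.
  lra.
have hx : 0 <= b / 2 - 1 - c by lra.
have hv : 0 <= alpha - 1 - b - c by lra.
rewrite -subr_ge0 (_ : _ - _ =
    (2 * t + K) * (ip (y t) (D t) - G t)
    + ((b - 2) * t - K - b * beta - c * t) * ip (y t) (D t)
    + (alpha - 1 - b - c) * (t * ip (x' t) (x' t))
    + (b / 2 - 1 - c) * (t * eps t * ip (x t) (x t))
    + b / 2 * (t * eps t * ip (y t) (y t))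
    + (C0 * (t * eps t) - kappa * beta * (t ^+ 2 * ip (D t) (D t)) -
    (t ^+ 2 * eps' t / 2 * ip (x t) (x t) - t ^+ 2 * eps t * beta * ip (D t) (x t)
      - beta * t ^+ 2 * ip (D t) (D t)))
    + beta * (t * (kappa * t - beta - c * t)) * ip (D t) (D t)).
  by nonneg.
rewrite /quadratic_energy' /linear_energy' /dissipation /K /ss.
have -> : ip (y t) (x t) = ip (y t) (y t) / 2 + ip (x t) (x t) / 2 - ip xstar xstar / 2.
  by rewrite /dist !ipE (ipC ip xstar (x t)); field.
by field.
Unshelve. all: by end_near. Qed.

(** * Convergence of the energies *)

Context (eps_int : (\int[lebesgue_measure]_(t in `[t0, +oo[) (t * eps t)%:E < +oo)%E).

Lemma weighted_eps_primitive : exists Phi (M l : R),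
  [/\ forall t, t0 < t -> is_derive t (1 : R) Phi (t * eps t),
      forall t, t0 < t -> Phi t <= M & Phi t @[t --> +oo] --> l].
Proof.
have epsc : {within `[t0, +oo[, continuous eps}.
  apply: derivable_in_within_continuous => t t0t.
  by have [+ _] := eps_C1; apply; rewrite /= in_itv/= andbT.
have fc : {within `[t0, +oo[, continuous (fun t => t * eps t)}.
  move=> t; apply: cvgM; last exact: epsc.
  by apply: continuous_subspaceT => s; exact: cvg_id.
have f0 t : t0 <= t -> 0 <= t * eps t.
  by move=> t0t; rewrite mulr_ge0 ?eps_ge0// (le_trans _ t0t)// ltW.
have [dPhi _] := continuous_primitive fc.
have [M PhiM] := finite_integral_primitive_le fc f0 eps_int.
pose Phi t := (\int[lebesgue_measure]_(s in `[t0, t]) (s * eps s))%R.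
have [l Phil] : exists l : R, Phi t @[t --> +oo] --> l.
  apply: (is_derive_ge0_cvgy dPhi) => [t /ltW /f0//|t _]; exact: PhiM.
by exists Phi, M, l; split=> // t _; exact: PhiM.
Qed.

Context (eps_cond :
    (exists a t1 : R, [/\ 1 < a, t0 <= t1 &
       forall t, t1 <= t -> eps' t <= - (a * beta / 2) * eps t ^+ 2]) \/
    (exists a t1 : R, [/\ 0 < a, t0 <= t1 &
       forall t, t1 <= t -> eps t <= a / t])).

(** Subtracting C times a primitive of t eps makes the energy nonincreasing; it stays bounded below,
    so it converges, and so does the energy. [F] is exposed because its decrease also bounds
    integrals of the dissipation. *)
Lemma lyapunov_function b : 2 < b -> b < alpha - 1 ->
  exists (F F' : R -> R) (c T m l : R),
    [/\ 0 < c, t0 <= T,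
        forall t, T < t -> is_derive t (1 : R) F (F' t),
        forall t, T < t -> F' t <= - (c * dissipation t) &
        forall t, T < t -> m <= F t] /\
    quadratic_energy t + b * linear_energy t @[t --> +oo] --> l.
Proof.
move=> b2 ba.
have [kappa [C0 [kappa0 C00 cross]]] := cross_term_le eps_cond.
have [c [C [c0 C_ge0 diss]]] := energy_dissipation kappa0 C00 cross b2 ba.
have [Phi [M [lPhi [dPhi PhiM Phil]]]] := weighted_eps_primitive.
have [S [_ SP]] := diss.
pose T := Num.max (Num.max t0 S) (beta * (b + 2 - alpha)).
have TP t : T < t -> [/\ t0 < t, S < t & beta * (b + 2 - alpha) < t].
  by rewrite /T !gt_max => /andP[/andP[-> ->] ->].
pose E t := quadratic_energy t + b * linear_energy t.
pose F t := E t - C * Phi t.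
pose F' t := quadratic_energy' t + b * linear_energy' t - C * (t * eps t).
have dF t : T < t -> is_derive t (1 : R) F (F' t).
  move=> /TP[t0t _ _]; have dP := is_derive_mull C (dPhi _ t0t).
  have dp := is_derive_mull b (is_derive_linear_energy t0t).
  exact: is_deriveB (is_deriveD (is_derive_quadratic_energy t0t) dp) dP.
have F'le t : T < t -> F' t <= - (c * dissipation t).
  by move=> /TP[_ /SP h _]; rewrite /F' lerBlDl.
have mF t : T < t -> - (C * M) <= F t.
  move=> /TP[t0t _ bt]; rewrite /F -[leLHS]add0r lerD ?lerN2 ?ler_wpM2l ?PhiM//.
  by apply: energy_ge0 => //; apply: ltW => //; rewrite (lt_trans _ b2).
have diss0 t : T < t -> 0 <= dissipation t.
  move=> /TP[t0t _ _]; have t_ge0 : 0 <= t by rewrite ltW// (lt_trans t0_gt0).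
  have xx := ip_ge0 ip_norm (x t); have vv := ip_ge0 ip_norm (x' t).
  have DD := ip_ge0 ip_norm (D t); have e0 := eps_ge0 (ltW t0t).
  have yD : 0 <= ip (y t) (D t) by rewrite (le_trans (gap_ge0 t))// gap_le.
  by rewrite /dissipation; nonneg.
have [l Fl] : exists l : R, F t @[t --> +oo] --> l.
  apply: (cvgy_nonincreasing _ mF).
  apply: (is_derive_le0_nonincreasing dF) => t Tt.
  by apply: le_trans (F'le _ Tt) _; rewrite oppr_le0 mulr_ge0 ?diss0// ltW.
exists F, F', c, T, (- (C * M)), (l + C * lPhi); split; first split=> //.
  by rewrite !le_max lexx.
rewrite [X in X @ _ --> _](_ : _ = fun t => F t + C * Phi t).
  by apply: cvgD => //; apply: cvgMl_tmp.
by apply/funext => t; rewrite /F subrK.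
Qed.

(** It rests on |v|^2 / 2 + |x' - beta D|^2 / 2 = |x'|^2 + beta^2 |D|^2, where beta^2 t <= beta t^2
    once beta <= t. *)
Lemma dissipation_ge_main_energy t : t0 < t -> beta <= t ->
  main_energy t / t <= dissipation t.
Proof.
move=> t0t bt; have t_gt0 : 0 < t by exact: lt_trans t0t.
have t_ge0 := ltW t_gt0; have e0 := eps_ge0 (ltW t0t).
have xx := ip_ge0 ip_norm (x t); have DD := ip_ge0 ip_norm (D t).
have ww := ip_ge0 ip_norm (x' t - beta *: D t).
have yG : 0 <= ip (y t) (D t) - G t by rewrite subr_ge0 gap_le.
have bt' : 0 <= t - beta by rewrite subr_ge0.
rewrite -subr_ge0 (_ : _ - _ = t * (ip (y t) (D t) - G t)
    + t / 2 * (eps t * ip (x t) (x t))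
    + t / 2 * ip (x' t - beta *: D t) (x' t - beta *: D t)
    + beta * t * ((t - beta) * ip (D t) (D t))).
  by nonneg.
rewrite /main_energy /dissipation /damped_velocity; move: (y t) => z.
by rewrite !ipE (ipC ip (D t) (x' t)); field; rewrite gt_eqF.
Qed.

(** All summands of r are nonnegative, so r -> 0 will give the three final estimates at once. *)
Lemma main_energy_ge t : t0 < t ->
  [/\ 0 <= main_energy t, t ^+ 2 * G t <= main_energy t,
      t ^+ 2 * (eps t * ip (x t) (x t)) <= 2 * main_energy t &
      t ^+ 2 * ip (v t) (v t) <= 2 * main_energy t].
Proof.
move=> t0t; have e0 := eps_ge0 (ltW t0t); have G0 := gap_ge0 t.
have xx := ip_ge0 ip_norm (x t); have vv := ip_ge0 ip_norm (v t).
have h1 : 0 <= t ^+ 2 * G t by nonneg.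
have h2 : 0 <= t ^+ 2 * (eps t * ip (x t) (x t)) by nonneg.
have h3 : 0 <= t ^+ 2 * ip (v t) (v t) by nonneg.
by rewrite /main_energy; split; lra.
Qed.

(** * Convergence of the trajectory *)

Context (alpha_gt3 : 3 < alpha).

Lemma within_continuous_solution : {within `[t0, +oo[, continuous x}.
Proof.
apply: derivable_in_within_continuous => t t0t.
by have [[[+ _] _] _ _ _] := x_sol; apply; rewrite /= in_itv/= andbT.
Qed.

Lemma within_continuous_dist : {within `[t0, +oo[, continuous y}.
Proof.
move=> t; apply: cvgB; last exact: cvg_cst.
exact: within_continuous_solution.
Qed.

Lemma within_continuous_grad : {within `[t0, +oo[, continuous D}.
Proof.
move=> t; have gc : {for x t, continuous (gradient ip g)}.
  by apply: differentiable_continuous; exact: g_diff2.2.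
have xc : {within `[t0, +oo[, continuous x} by exact: within_continuous_solution.
exact: (cvg_comp _ _ (xc t) gc).
Qed.

Lemma asymptotics :
  [/\ lebesgue_measure.-integrable `[t0, +oo[ (fun t => (t * ip (D t) (y t))%:E),
      exists l : R, `|y t| @[t --> +oo] --> l,
      exists l : R, t * ip (v t) (y t) @[t --> +oo] --> l &
      main_energy t @[t --> +oo] --> (0 : R)].
Proof.
have a2 : 0 <= alpha - 2 by have := alpha_gt3; lra.
have a1 : 0 < alpha - 1 by have := alpha_gt3; lra.
(* Then 2 + d and 2 + 2 d both lie strictly between 2 and alpha - 1 = 2 + 3 d. *)
pose d := (alpha - 3) / 3.
have d0 : 0 < d by rewrite divr_gt0// subr_gt0.
pose p := linear_energy; pose q := quadratic_energy.
have [||F [F' [c [T [m [l1 [[c0 t0T dF F'le mF] E1]]]]]]] := @lyapunov_function (2 + d).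
- by rewrite ltrDl.
- by move: d0; rewrite /d; lra.
have [||_ [_ [_ [_ [_ [l2 [_ E2]]]]]]] := @lyapunov_function (2 + 2 * d).
- by rewrite ltrDl mulr_gt0.
- by move: d0; rewrite /d; lra.
have pl : p t @[t --> +oo] --> (l2 - l1) / d.
  rewrite (_ : p = fun t => ((q t + (2 + 2 * d) * p t) - (q t + (2 + d) * p t)) / d).
    by apply: cvgMr_tmp; apply: cvgB.
  by apply/funext => t; field; rewrite gt_eqF.
set lp := (l2 - l1) / d in pl.
have ql : q t @[t --> +oo] --> l1 - (2 + d) * lp.
  rewrite (_ : q = fun t => (q t + (2 + d) * p t) - (2 + d) * p t).
    by apply: cvgB => //; apply: cvgMl_tmp.
  by apply/funext => t; rewrite addrK.
set lq := l1 - _ in ql.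
have iy : t^-1 @[t --> +oo] --> (0 : R).
  apply/gtr0_cvgV0; last exact: cvg_id.
  by near=> t; near: t; exact: nbhs_pinfty_gt (num_real _).
(* Here t G <= q / t, because t^2 G <= r <= q. *)
have tG : t * G t @[t --> +oo] --> (0 : R).
  have qi : q t * t^-1 @[t --> +oo] --> (0 : R).
    by rewrite -(mulr0 lq); apply: cvgM.
  apply: (@squeeze_cvgr _ _ _ _ (cst 0) (fun t => q t * t^-1)) => //.
    near=> t.
    have t0t : t0 < t by near: t; exact: nbhs_pinfty_gt (num_real _).
    have t_gt0 : 0 < t by exact: lt_trans t0t.
    have [_ mG _ _] := main_energy_ge t0t.
    have G0 := gap_ge0 t; have t_ge0 := ltW t_gt0.
    apply/andP; split; first by nonneg.
    rewrite ler_pdivlMr// mulrAC -expr2; apply: le_trans mG _.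
    by rewrite /q /quadratic_energy lerDl; nonneg.
  exact: cvg_cst.
have ml : main_energy t @[t --> +oo] --> lq.
  rewrite (_ : main_energy = fun t => q t - beta * (alpha - 2) * (t * G t)).
    have -> : lq = lq - beta * (alpha - 2) * 0 by rewrite mulr0 subr0.
    by apply: cvgB => //; apply: cvgMl_tmp.
  by apply/funext => t; rewrite /q /quadratic_energy addrK.
have lq0 : lq = 0.
  apply/eqP; rewrite eq_le; apply/andP; split.
    pose T1 := Num.max T beta.
    have T1P t : T1 < t -> [/\ T < t, t0 < t & beta < t].
      by rewrite /T1 gt_max => /andP[Tt ->]; split=> //; exact: le_lt_trans Tt.
    apply: (@log_decay_limit_le0 _ F F' main_energy T1 m c) => //.
    - by move=> t /T1P[? _ _]; exact: dF.
    - move=> t /T1P[Tt t0t bt]; apply: le_trans (F'le _ Tt) _.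
      by rewrite lerN2 ler_pM2l// dissipation_ge_main_energy// ltW.
    - by move=> t /T1P[? _ _]; exact: mF.
  apply: (cvgr_to_ge ml); near=> t.
  have t0t : t0 < t by near: t; exact: nbhs_pinfty_gt (num_real _).
  by have [] := main_energy_ge t0t.
have yD0 t : 0 <= ip (y t) (D t) by rewrite (le_trans (gap_ge0 t))// gap_le.
have T_gt0 t : T < t -> 0 < t by move=> Tt; rewrite (lt_trans t0_gt0)// (le_lt_trans t0T).
have dissge t : T < t -> t * ip (y t) (D t) <= dissipation t.
  move=> Tt; have t_ge0 := ltW (T_gt0 _ Tt).
  have xx := ip_ge0 ip_norm (x t); have DD := ip_ge0 ip_norm (D t).
  have vv := ip_ge0 ip_norm (x' t).
  have e0 : 0 <= eps t by rewrite eps_ge0// (le_trans t0T)// ltW.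
  by rewrite /dissipation -!addrA lerDl; nonneg.
have yDc : {within `[t0, +oo[, continuous (fun t => ip (y t) (D t))}.
  move=> t; apply: (cvg_ip ip_norm); first exact: within_continuous_dist.
  exact: within_continuous_grad.
have tyDc : {within `[t0, +oo[, continuous (fun t => t * ip (y t) (D t))}.
  move=> t; apply: cvgM; last exact: yDc.
  by apply: continuous_subspaceT => s; exact: cvg_id.
have tyD0 t : t0 <= t -> 0 <= t * ip (y t) (D t).
  by move=> t0t; rewrite mulr_ge0// (le_trans _ t0t)// ltW.
have [dN1 N1c] := continuous_primitive tyDc.
have [M1 N1M] : exists M, forall t, t0 < t ->
    (\int[lebesgue_measure]_(s in `[t0, t]) (s * ip (y s) (D s)))%R <= M.
  apply: (dissipated_primitive_le dF _ mF c0 t0T dN1) => t.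
    by move=> Tt; apply: le_trans (F'le _ Tt) _; rewrite lerN2 ler_pM2l// dissge.
  by move=> /ltW; exact: tyD0.
have [dN _] := continuous_primitive yDc.
pose N t := (\int[lebesgue_measure]_(s in `[t0, t]) ip (y s) (D s))%R.
have [lN Nl] : exists l : R, N t @[t --> +oo] --> l.
  (* Beyond 1, <y, D> <= t <y, D>, so the dissipation bounds this unweighted integral as well. *)
  pose T1 := Num.max T 1.
  have T1P t : T1 < t -> T < t /\ 1 < t by rewrite /T1 gt_max => /andP.
  have [M NM] : exists M, forall t, t0 < t -> N t <= M.
    apply: (@dissipated_primitive_le _ F F' _ _ t0 T1 m c _ _ _ c0 _ dN) => //.
    - by move=> t /T1P[? _]; exact: dF.
    - move=> t /T1P[Tt t1]; apply: le_trans (F'le _ Tt) _; rewrite lerN2 ler_pM2l//.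
      by apply: le_trans (dissge _ Tt); rewrite ler_peMl// ltW.
    - by move=> t /T1P[? _]; exact: mF.
    - by rewrite le_max t0T.
  by apply: (is_derive_ge0_cvgy dN _ NM) => t _; exact: yD0.
pose k t := 2^-1 * ip (y t) (y t) + beta * N t.
pose k' t := 2^-1 * (ip (x' t) (y t) + ip (y t) (x' t)) + beta * ip (y t) (D t).
have dk t : t0 < t -> is_derive t (1 : R) k (k' t).
  move=> t0t; have dy := is_derive_dist t0t.
  have d1 := is_derive_mull 2^-1 (is_derive_ip ip_norm dy dy).
  have d2 := is_derive_mull beta (dN _ t0t).
  exact: is_deriveD d1 d2.
(* The 0 is the limit of t G. *)
pose L := lp + beta * 0 + (alpha - 1) * beta * lN.
have kL : t * k' t + (alpha - 1) * k t @[t --> +oo] --> L.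
  rewrite (_ : (fun t => _) = (fun t => p t + beta * (t * G t) + (alpha - 1) * beta * N t)).
    apply: cvgD; last exact: cvgMl_tmp.
    by apply: cvgD => //; apply: cvgMl_tmp.
  apply/funext => t; rewrite /k /k' /p /linear_energy /damped_velocity.
  by move: (y t) (N t) => z n; rewrite !ipE (ipC ip (x' t) z); field.
have kl := ode_cvg a1 dk kL.
set lk := L / _ in kl.
have yyl : ip (y t) (y t) @[t --> +oo] --> 2 * (lk - beta * lN).
  rewrite (_ : (fun t => _) = (fun t => 2 * (k t - beta * N t))).
    by apply: cvgMl_tmp; apply: cvgB => //; apply: cvgMl_tmp.
  by apply/funext => t; rewrite /k; field.
set ly := 2 * _ in yyl.
split.
- have -> : (fun t => (t * ip (D t) (y t))%:E) =
      EFin \o (fun t => t * ip (y t) (D t)) by apply/funext => t; rewrite /= (ipC ip).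
  exact: bounded_primitive_integrable tyDc tyD0 dN1 N1c N1M.
- exists (Num.sqrt ly).
  rewrite (_ : (fun t => _) = (fun t => Num.sqrt (ip (y t) (y t)))).
    by apply: (cvg_comp _ _ yyl); exact: sqrt_continuous.
  by apply/funext => t; rewrite -ip_norm sqrtr_sqr normr_id.
(* The definition of p is solved for t <v, y>, all other terms having known limits. *)
- exists (lp + beta * 0 - (alpha - 1) / 2 * ly).
  rewrite (_ : (fun t => _) =
    (fun t => p t + beta * (t * G t) - (alpha - 1) / 2 * ip (y t) (y t))).
    apply: cvgB; last exact: cvgMl_tmp.
    by apply: cvgD => //; apply: cvgMl_tmp.
  by apply/funext => t; rewrite /p /linear_energy (ipC ip (v t)); ring.
- by rewrite -lq0.
Unshelve. all: by end_near. Qed.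

End TikhonovHessian.

Theorem theorem3p4 (R : realType) (H : completeNormedModType R)
  (ip : {dot H for (@idfun R)}) (ip_norm : inner_product_norm ip)
  (t0 : R) (t0_gt0 : 0 < t0)
  (g : H -> R)
  (g_convex : convex_function [set: convex_lmodType H] g)
  (g_diff2 : twice_differentiable ip g)
  (grad_lip : lipschitz_on_bounded_sets (gradient ip g))
  (argmin_neq0 : argmin g !=set0)
  (eps : R -> R)
  (eps_ge0 : forall t, t0 <= t -> 0 <= eps t)
  (eps_noninc : forall s t, t0 <= s -> s <= t -> eps t <= eps s)
  (eps_C1 : C1_on `[t0, +oo[ eps)
  (eps_lim : eps t @[t --> +oo] --> 0)
  (alpha beta : R) (beta_ge0 : 0 <= beta)
  (u0 v0 : H) (x : R -> H)
  (x_sol : tikhonov_hessian_solution ip g eps alpha beta t0 u0 v0 x)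
  (eps_int : (\int[lebesgue_measure]_(t in `[t0, +oo[) (t * eps t)%:E < +oo)%E)
  (eps_cond :
    (exists a t1 : R, [/\ 1 < a, t0 <= t1 &
       forall t, t1 <= t ->
         derive_in `[t0, +oo[ eps t <= - (a * beta / 2) * eps t ^+ 2]) \/
    (exists a t1 : R, [/\ 0 < a, t0 <= t1 &
       forall t, t1 <= t -> eps t <= a / t]))
  (xstar : H) (xstar_min : argmin g xstar)
  (alpha_gt3 : 3 < alpha) :
  let x' := derive_in `[t0, +oo[ x in
  lebesgue_measure.-integrable `[t0, +oo[
      (fun t => (t * ip (gradient ip g (x t)) (x t - xstar))%:E) /\
  (exists l : R, `|x t - xstar| @[t --> +oo] --> l) /\
  (exists l : R,
     t * ip (x' t + beta *: gradient ip g (x t)) (x t - xstar)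
       @[t --> +oo] --> l) /\
  (fun t => g (x t) - min_value g) =o_ (pinfty_nbhs R) (fun t => 1 / t ^+ 2) /\
  (fun t => `|x' t + beta *: gradient ip g (x t)|)
    =o_ (pinfty_nbhs R) (fun t => 1 / t) /\
  t ^+ 2 * eps t * `|x t| ^+ 2 @[t --> +oo] --> 0.
Proof.
move=> x'; have [int_yD dist_cvg ip_cvg main0] := asymptotics ip_norm t0_gt0
  g_convex g_diff2 eps_ge0 eps_noninc eps_C1 beta_ge0 x_sol xstar_min eps_int
  eps_cond alpha_gt3.
have ge := main_energy_ge ip_norm eps_ge0 beta x xstar_min.
have gt0 : \forall t \near pinfty_nbhs R, t0 < t.
  exact: nbhs_pinfty_gt (num_real _).
(* [min_value] is an infimum; it is attained at [xstar]. *)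
have minE : min_value g = g xstar.
  apply/eqP; rewrite eq_le; apply/andP; split.
    by apply: ge_inf; [exists (g xstar) => _ [z _ <-]; exact: xstar_min|exists xstar].
  by apply: lb_le_inf; [exists (g xstar), xstar|move=> _ [z _ <-]; exact: xstar_min].
split; first exact: int_yD.
split; first exact: dist_cvg.
split; first exact: ip_cvg.
split; last split.
- apply/eqoP => e e0.
  have me : \forall t \near pinfty_nbhs R, main_energy ip t0 g eps beta x xstar t <= e.
    exact: (cvgr_le _ main0).
  near=> t; have t0t : t0 < t by near: t.
  have [_ mG _ _] := ge t t0t; have t_gt0 := lt_trans t0_gt0 t0t.
  rewrite minE ger0_norm ?subr_ge0 ?xstar_min// ger0_norm ?divr_ge0 ?sqr_ge0//.
  rewrite mulrA mulr1 ler_pdivlMr ?exprn_gt0// mulrC.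
  by apply: le_trans mG _; near: t.
(* |v| <= e / t amounts to t^2 |v|^2 <= e^2, and t^2 |v|^2 is at most twice the main energy. *)
- apply/eqoP => e e0; have e20 : 0 < e ^+ 2 / 2 by rewrite divr_gt0 ?exprn_gt0.
  have me : \forall t \near pinfty_nbhs R,
      main_energy ip t0 g eps beta x xstar t <= e ^+ 2 / 2.
    exact: (cvgr_le _ main0).
  near=> t; have t0t : t0 < t by near: t.
  have [_ _ _ mv] := ge t t0t; have t_gt0 := lt_trans t0_gt0 t0t.
  have t_ge0 := ltW t_gt0; have e_ge0 := ltW e0.
  rewrite normr_id [X in e * X]ger0_norm; last by rewrite divr_ge0.
  rewrite mulrA mulr1 ler_pdivlMr// -ler_sqr ?nnegrE ?mulr_ge0//.
  rewrite exprMn ip_norm mulrC.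
  apply: le_trans mv _; rewrite -ler_pdivlMl// mulrC.
  by near: t.
- have m2 : 2 * main_energy ip t0 g eps beta x xstar t @[t --> +oo] --> (0 : R).
    by rewrite -(mulr0 2); apply: cvgMl_tmp.
  apply: (@squeeze_cvgr _ _ _ _ (cst 0)
    (fun t => 2 * main_energy ip t0 g eps beta x xstar t)) => //.
    near=> t; have t0t : t0 < t by near: t.
    have [_ _ mx _] := ge t t0t; rewrite ip_norm -mulrA mx andbT.
    by rewrite mulr_ge0 ?sqr_ge0// mulr_ge0 ?eps_ge0 ?ip_ge0// ltW.
  exact: cvg_cst.
Unshelve. all: by end_near. Qed.
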